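(* Assume (a), (b) (for every dataset $z$), (d) and (e). Then the generalization error satisfies $$\bar{\bar G}(P_{\Theta|Z},P_Z)=\lambda\int\!\!\int\Big(f\Big(\frac{dP^{(Q,\lambda)}_{\Theta|Z=z}}{dQ}(\theta)\Big)+f^*\Big(-\frac{L_z(\theta)+N_{Q,z}(\lambda)}{\lambda}\Big)\Big)\Big(\frac{dP_{\Theta|Z=z}}{dP^{(Q,\lambda)}_{\Theta|Z=z}}(\theta)-\frac{dP_\Theta}{dP^{(Q,\lambda)}_{\Theta|Z=z}}(\theta)\Big)dQ(\theta)\,dP_Z(z).$$
   Context: Setting. - $\mathcal{M}\subseteq\mathbb{R}^d$; $h:\mathcal{M}\times\mathcal{X}\to\mathcal{Y}$; the loss $\ell:\mathcal{Y}\times\mathcal{Y}\to[0,\infty)$ satisfies $\ell(y,y)=0$. - For a dataset $z=((x_1,y_1),\dots,(x_n,y_n))\in(\mathcal{X}\times\mathcal{Y})^n$, $L_z(\theta)=\frac1n\sum_i\ell(h(\theta,x_i),y_i)$ and $R_z(P)=\int L_z\,dP$. - $Q$ is a Borel probability measure on $\mathcal{M}$, and $\triangle_Q(\mathcal{M})$ is the set of probability measures $P\ll Q$. Fix $\lambda>0$. - $f:[0,\infty)\to\mathbb{R}$ is convex with $f(1)=0$; $D_f(P\|Q)=\int f(\frac{dP}{dQ})dQ$. - $\dot f$ is the derivative of $f$ on $(0,\infty)$ and $\dot f^{-1}$ its inverse. - $f^*(t)=\sup_x(tx-f(x))$ is the Legendre–Fenchel transform. Assumptions. - (a) $f$ is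 strictly convex and differentiable. - (b) For the given $z$, there exists $\beta$ with $\dot f^{-1}\big(-\frac{\beta+L_z(\theta)}{\lambda}\big)>0$ on $\operatorname{supp}Q$ and $\int\dot f^{-1}\big(-\frac{\beta+L_z(\theta)}{\lambda}\big)dQ=1$. Normalization and solution. $N_{Q,z}(\lambda)$ denotes this $\beta$. $P^{(Q,\lambda)}_{\Theta|Z=z}$ is the unique minimizer of $R_z(P)+\lambda D_f(P\|Q)$ over $\triangle_Q(\mathcal{M})$, with density $\frac{dP^{(Q,\lambda)}_{\Theta|Z=z}}{dQ}(\theta)=\dot f^{-1}\big(-\frac{N_{Q,z}(\lambda)+L_z(\theta)}{\lambda}\big)$; it is mutually absolutely continuous with $Q$. Learning algorithm and generalization error. - $P_Z$ is a probability measure on $(\mathcal{X}\times\mathcal{Y})^n$. - $P_{\Theta|Z}$ is a conditional probability (learning algorithm) assigning to each dataset $z$ a probability measure $P_{\Theta|Z=z}$ on $\mathcal{M}$. - $P_\Theta(\mathcal{C})=\int P_{\Theta|Z=z}(\mathcal{C})\,dP_Z(z)$ for measurable $\mathcal{C}\subseteq\mathcal{M}$. - The generalization error is $\bar{\bar G}(P_{\Theta|Z},P_Z)=\int\!\int\big(R_u(P_{\Theta|Z=z})-R_z(P_{\Theta|Z=z})\big)dP_Z(u)\,dP_Z(z)$. Further assumptions. - (d) For all $z$, $P_{\Theta|Z=z}\ll P_\Theta$, and $P_\Theta\in\triangle_Q(\mathcal{M})$. - (e) $P_\Theta$ and $Q$ are mutually absolutely continuous.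
   Formalization: The expected risks ∫∫L_z dP_Θ dP_Z and ∫∫L_z dP_{Θ|Z=z} dP_Z are assumed finite (without this the identity can fail, e.g. 0 against +∞); h and the loss are assumed jointly measurable, and z ↦ P_{Θ|Z=z}(C) measurable. *)

(* Defs.v *)
From HB Require Import structures.
From mathcomp Require Import all_boot all_order all_algebra.
From mathcomp Require Import all_classical all_reals all_analysis.
From mathcomp Require Import measurable_realfun.
Set Implicit Arguments. Unset Strict Implicit. Unset Printing Implicit Defensive.
Import Order.TTheory GRing.Theory Num.Theory.
Import numFieldNormedType.Exports.
Local Open Scope classical_set_scope.
Local Open Scope ring_scope.

Section defs.
Context (R : realType).

(* Inverse of the derivative of f on (0,oo):  dfinv f t  is the (unique, when
   f is strictly convex) x > 0 with f'(x) = t, and 0 when no such x exists.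
   Hence  0 < dfinv f t  says exactly that t lies in the range of f' on (0,oo)
   and the inverse value is positive. *)
Definition dfinv (f : R -> R) (t : R) : R :=
  xget 0 [set x | 0 < x /\ derive1 f x = t].

Definition fstar (f : R -> R) (t : R) : \bar R :=
  ereal_sup [set ((t * x - f x)%:E) | x in [set x : R | 0 <= x]].

Definition strictly_convex_on_nonneg (f : R -> R) : Prop :=
  forall x y t : R, 0 <= x -> 0 <= y -> x != y -> 0 < t < 1 ->
    f (t * x + (1 - t) * y) < t * f x + (1 - t) * f y.

Definition emp_risk {dT dX dY} {T : measurableType dT} {X : measurableType dX}
  {Y : measurableType dY} (n : nat) (h : T -> X -> Y) (ell : Y -> Y -> R)
  (z : n.-tuple (X * Y)%type) (theta : T) : R :=
  n%:R^-1 * \sum_(i < n) ell (h theta (tnth z i).1) (tnth z i).2.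

Definition risk {dT} {T : measurableType dT} (Lz : T -> R)
  (P : {measure set T -> \bar R}) : \bar R :=
  (\int[P]_theta (Lz theta)%:E)%E.

Definition gibbs_density (f : R -> R) (lam beta : R) {dT} {T : measurableType dT}
  (Lz : T -> R) (theta : T) : R :=
  dfinv f (- ((beta + Lz theta) / lam)).

Definition normalizing {dT} {T : measurableType dT} (Q : probability T R)
  (f : R -> R) (lam : R) (Lz : T -> R) (beta : R) : Prop :=
  {ae Q, forall theta, 0 < gibbs_density f lam beta Lz theta} /\
  (\int[Q]_theta (gibbs_density f lam beta Lz theta)%:E = 1)%E.

Definition normalizer {dT} {T : measurableType dT} (Q : probability T R)
  (f : R -> R) (lam : R) (Lz : T -> R) : R :=
  xget 0 [set beta | normalizing Q f lam Lz beta].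

Definition gen_error {dT dZ} {T : measurableType dT} {Z : measurableType dZ}
  (L : Z -> T -> R) (K : Z -> {measure set T -> \bar R})
  (PZ : probability Z R) : \bar R :=
  (\int[PZ]_z \int[PZ]_u (risk (L u) (K z) - risk (L z) (K z)))%E.

End defs.

(* Main.v *)
(* Write g for the Gibbs density and t = -(L_z + N)/lam, so that f'(g) = t
   Q-almost everywhere. Equality in Fenchel-Young gives f(g) + f^*(t) = t g, and
   the chain rule for Radon-Nikodym derivatives (g = dP^*/dQ) turns the inner
   integral into \int t dP_{Theta|Z=z} - \int t dP_Theta. The constant N cancels
   because both are probabilities, leaving
   (1/lam) (R_z(P_Theta) - R_z(P_{Theta|Z=z})). By Tonelli the average of
   R_z(P_Theta) over z is that of R_u(P_{Theta|Z=z}) over independent z and u,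
   so averaging over z gives the generalization error. *)
Require Import Defs.
From HB Require Import structures.
From mathcomp Require Import all_boot all_order all_algebra.
From mathcomp Require Import all_classical all_reals all_analysis.
From mathcomp Require Import measurable_realfun.
From mathcomp Require Import ring lra.
Import Order.TTheory GRing.Theory Num.Theory.
Import numFieldNormedType.Exports.
Local Open Scope classical_set_scope.
Local Open Scope ring_scope.
Local Open Scope charge_scope.
Set Implicit Arguments. Unset Strict Implicit.

(** * Integrals up to null sets, and densities *)

Section ae_eq_integral_measurable_right.
Local Open Scope ereal_scope.
Import HBNNSimple.
Context d (T : measurableType d) (R : realType) (mu : {measure set T -> \bar R}).

Let ge0_ae_eq_integral_measurabler (f g : T -> \bar R) :
  (forall x, 0 <= f x) -> (forall x, 0 <= g x) -> measurable_fun setT g ->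
  ae_eq mu setT f g -> \int[mu]_x f x = \int[mu]_x g x.
Proof.
move=> f0 g0 mg [N [mN N0 subN]]; apply/eqP; rewrite eq_le; apply/andP; split.
- rewrite (ge0_integralTE mu f0); apply: ge_ereal_sup => _ [h hf <-].
  rewrite -integralT_nnsfun; apply: ae_ge0_le_integral => //.
  + by move=> x _; rewrite lee_fin fun_ge0.
  + exact/measurable_EFinP.
  + exists N; split => // x /= xN; apply: subN => /= xfg; apply: xN => _.
    by rewrite -xfg.
(* For the reverse inequality [N] is removed from the integral of [g]: a simple function below [g]
   off [N] and below [0] on [N] also lies below [f]. *)
- rewrite (@ge0_negligible_integral _ _ _ mu setT N g)// setTD integral_mkcond.
  rewrite (ge0_integralTE mu f0) ge0_integralTE; last first.
    by move=> x; rewrite patchE; case: ifP.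
  apply: le_ereal_sup => _ [h hg <-]; exists h => // x.
  apply: (le_trans (hg x)); rewrite patchE; case: ifPn => // /set_mem xN.
  by apply: contrapT => fg; apply: xN; apply: subN => /= /(_ Logic.I) fge;
    apply: fg; rewrite fge.
Qed.

(* Integrals of arbitrary functions are defined through suprema over measurable
   simple functions, so changing a measurable function on a null set does not
   alter its integral even if measurability is lost. *)
Lemma ae_eq_integral_measurabler (f g : T -> \bar R) : measurable_fun setT g ->
  ae_eq mu setT f g -> \int[mu]_x f x = \int[mu]_x g x.
Proof.
move=> mg /ae_eq_funeposneg[fgp fgn]; rewrite integralE [RHS]integralE.
congr (_ - _); apply: ge0_ae_eq_integral_measurabler => //;
  [exact: measurable_funepos | exact: measurable_funeneg].
Qed.

End ae_eq_integral_measurable_right.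

(** For a measurable product only absolute values matter, so [f] may be replaced by its absolute
    value and the derivative by the almost everywhere equal version
    [Radon_Nikodym_SigmaFinite.f]. *)
Lemma integrable_mul_Radon_Nikodym d (T : measurableType d) (R : realType)
    (nu : {finite_measure set T -> \bar R})
    (mu : {sigma_finite_measure set T -> \bar R}) (f : T -> \bar R) :
  nu `<< mu -> nu.-integrable setT f ->
  mu.-integrable setT
    (fun x => f x * ('d (charge_of_finite_measure nu) '/d mu) x)%E.
Proof.
move=> numu intf; have mf := measurable_int _ intf.
have intF : mu.-integrable setT
    (fun x => `|f x| * Radon_Nikodym_SigmaFinite.f nu mu x)%E.
  apply: (Radon_Nikodym_SigmaFinite.integrableM numu _ measurableT) => //.
  exact: integrable_abse.
have md : measurable_fun setT ('d (charge_of_finite_measure nu) '/d mu).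
  by apply: measurable_int; exact: Radon_Nikodym_integrable.
apply/integrableP; split; first exact: emeasurable_funM.
have /integrableP[mF] := intF.
apply: le_lt_trans; rewrite le_eqVlt; apply/orP; left; apply/eqP.
apply: ae_eq_integral => //.
- by apply: measurableT_comp => //; exact: emeasurable_funM.
- exact: measurableT_comp.
- have := ae_eq_Radon_Nikodym_SigmaFinite numu measurableT.
  apply: filterS => x /= /(_ Logic.I) <- _.
  by rewrite !abseM abse_id.
Qed.

Lemma ae_eq_density_Radon_Nikodym d (T : measurableType d) (R : realType)
    (nu : {finite_measure set T -> \bar R})
    (mu : {sigma_finite_measure set T -> \bar R}) (g : T -> \bar R) :
  nu `<< mu -> measurable_fun setT g ->
  (forall A, measurable A -> nu A = \int[mu]_(x in A) g x)%E ->
  ae_eq mu setT ('d (charge_of_finite_measure nu) '/d mu) g.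
Proof.
move=> numu mg nug; apply: integral_ae_eq => //.
  exact: Radon_Nikodym_integrable.
move=> A _ mA; rewrite -nug//.
by rewrite -(@Radon_Nikodym_integral _ _ _ (charge_of_finite_measure nu)).
Qed.

Section positive_density.
Local Open Scope ereal_scope.
Context d (T : measurableType d) (R : realType) (mu nu : {measure set T -> \bar R}).
Variable g : T -> \bar R.
Hypothesis mg : measurable_fun setT g.
Hypothesis g0 : forall x, 0 <= g x.
Hypothesis nug : forall A, measurable A -> nu A = \int[mu]_(x in A) g x.

Lemma density_dominates : nu `<< mu.
Proof.
apply/null_content_dominatesP => A mA muA0; rewrite nug//.
apply: null_set_integral => //; exact: measurable_funTS.
Qed.

(** If [nu A = 0], the integral of [g] over [A] vanishes, so [g = 0] almost everywhere on [A]; since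
    [g] is almost everywhere positive, [A] is null. *)
Lemma dominates_positive_density : {ae mu, forall x, 0 < g x} -> mu `<< nu.
Proof.
move=> gpos; apply/null_content_dominatesP => A mA nuA0.
have mgA : measurable_fun A g by exact: measurable_funTS.
have /(ae_eq_integral_abs mu mA mgA).1 gA0 : \int[mu]_(x in A) `|g x| = 0.
  by under eq_integral do rewrite gee0_abs//; rewrite -nug.
apply: measure_negligible => //; rewrite -[A]setCK.
have : {ae mu, forall x, ~ A x}; last by [].
move: gA0; apply: filterS2 gpos => x /= gx gA0 Ax.
by move: gx; rewrite (gA0 Ax) ltxx.
Qed.

End positive_density.

(** * One-sided slopes and the intermediate value property of derivatives *)

Section directional_slope.
Context (R : realType) (f : R -> R) (x v c : R).
Hypothesis df : derivable f x 1.

Let slope_cvg : (h^-1 * (f (x + h * v) - f x)) @[h --> 0^'+] --> derive1 f x * v.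
Proof.
pose phi (h : R) := f (x + h * v).
have dphi : is_derive (0 : R) 1 phi (derive1 f x * v).
  have dl : is_derive (0 : R) 1 (fun h : R => x + h * v) v.
    by apply: is_derive_eq; rewrite /GRing.scale/= mul0r !add0r mulr1 mul1r.
  have df' : is_derive (x + 0 * v) 1 f (derive1 f x).
    rewrite mul0r addr0 derive1E; exact: DeriveDef.
  have := is_derive1_comp (f := f) (g := fun h : R => x + h * v) (x := 0).
  by move=> /(_ _ _ df' dl).
have [+ <-] := dphi.
move=> /cvg_ex[l /= hl].
have -> : 'D_1 phi 0 = l by exact: cvg_lim hl.
apply: cvg_dnbhs_at_right; rewrite (_ : (fun h => h^-1 * (f (x + h * v) - f x)) =
  (fun h : R => h^-1 *: (phi (h *: 1 + 0) - phi 0))); last first.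
  by apply/funext => h; rewrite /phi /GRing.scale/= mulr1 addr0 mul0r addr0.
exact: hl.
Qed.

(** The sign of [v] is free, so a single right-hand limit treats both directions along a segment
    starting at [x]. *)
Lemma ler_derive1_slope :
  (forall t, 0 < t < 1 -> f (x + t * v) - f x <= t * c) -> derive1 f x * v <= c.
Proof.
move=> fc; apply: (cvgr_to_le slope_cvg).
near=> t.
have t0 : 0 < t by near: t; exact: nbhs_right_gt.
rewrite ler_pdivrMl//; apply: fc; rewrite t0/=.
by near: t; exact: nbhs_right_lt.
Unshelve. all: by end_near. Qed.

Lemma ger_derive1_slope :
  (forall t, 0 < t < 1 -> t * c <= f (x + t * v) - f x) -> c <= derive1 f x * v.
Proof.
move=> fc; apply: (cvgr_to_ge slope_cvg).
near=> t.
have t0 : 0 < t by near: t; exact: nbhs_right_gt.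
rewrite ler_pdivlMl//; apply: fc; rewrite t0/=.
by near: t; exact: nbhs_right_lt.
Unshelve. all: by end_near. Qed.

End directional_slope.

(** The continuous function [phi] has a minimum on the segment. At [a] its slope is negative and at
    [b] positive, so the minimum is interior and [phi] has derivative zero there. *)
Lemma derive1_darboux (R : realType) (f : R -> R) (a b t : R) : a < b ->
  {in `[a, b], forall x, derivable f x 1} -> derive1 f a < t < derive1 f b ->
  exists2 c, a < c < b & derive1 f c = t.
Proof.
move=> ab df /andP[fat tfb].
pose phi := fun s => f s - t * s.
have dphi s : s \in `[a, b] -> is_derive s 1 phi (derive1 f s - t).
  move=> /df dfs; rewrite derive1E.
  have := DeriveDef dfs erefl => hd.
  by apply: is_derive_eq; rewrite /GRing.scale/= ?mulr1 ?mul0r ?addr0 ?mulr0.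
have [c cab cmin] : exists2 c, c \in `[a, b] &
    forall s, s \in `[a, b] -> phi c <= phi s.
  apply: EVT_min; first exact: ltW.
  by apply: derivable_within_continuous => s /dphi[].
have ain : a \in `[a, b] by rewrite in_itv/= lexx ltW.
have bin : b \in `[a, b] by rewrite in_itv/= lexx ltW.
have itv s : 0 < s < 1 -> a <= a + s * (b - a) <= b.
  move=> s01; nra.
have itv' s : 0 < s < 1 -> a <= b + s * (a - b) <= b.
  move=> s01; nra.
have ca : c != a.
  apply/eqP => ca; suff : t * (b - a) <= derive1 f a * (b - a).
    by rewrite ler_pM2r ?subr_gt0// leNgt fat.
  apply: ger_derive1_slope; first exact: df.
  move=> s /itv s01; have := cmin (a + s * (b - a)).
  by rewrite in_itv/= s01 ca /phi => /(_ isT); lra.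
have cb : c != b.
  apply/eqP => cb; suff : t * (a - b) <= derive1 f b * (a - b).
    by rewrite ler_nM2r ?subr_lt0// leNgt tfb.
  apply: ger_derive1_slope; first exact: df.
  move=> s /itv' s01; have := cmin (b + s * (a - b)).
  by rewrite in_itv/= s01 cb /phi => /(_ isT); lra.
have cab' : a < c < b.
  by move: cab; rewrite in_itv/= !le_eqVlt eq_sym (negbTE ca) (negbTE cb).
exists c => //; apply/eqP; rewrite -subr_eq0; apply/eqP.
have [_ <-] := dphi c cab.
apply: derive_val; apply: (@derive1_at_min _ phi a b c); first exact: ltW.
- by move=> s sab; have [] := dphi s (subset_itv_oo_cc sab).
- by rewrite in_itv.
- by move=> s sab; apply: cmin; exact: subset_itv_oo_cc.
Qed.

(** * Strict convexity: the inverse derivative and the conjugate *)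

Section strictly_convex.
Context (R : realType) (f : R -> R).
Hypothesis f_sconv : strictly_convex_on_nonneg f.
Hypothesis f_der : forall x : R, 0 < x -> derivable f x 1.

(** Convexity bounds the slopes from [x] towards [y] by [f y - f x]; strictness is lost in the
    limit. *)
Let tangent_le x y : 0 < x -> 0 <= y -> derive1 f x * (y - x) <= f y - f x.
Proof.
move=> x0 y0; have [->|yx] := eqVneq y x; first by rewrite !subrr mulr0.
apply: ler_derive1_slope; first exact: f_der.
move=> t t01; have /= := f_sconv y0 (ltW x0) yx t01.
have -> : t * y + (1 - t) * x = x + t * (y - x) by ring.
lra.
Qed.

(** Strictness is recovered by applying the weak tangent inequality at the midpoint, where [f] lies
    strictly below the chord. *)
Lemma tangent_lt x y : 0 < x -> 0 <= y -> y != x ->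
  derive1 f x * (y - x) < f y - f x.
Proof.
move=> x0 y0 yx; have h2 : 0 < (2^-1 : R) < 1 by lra.
have := f_sconv y0 (ltW x0) yx h2.
have m0 : 0 <= 2^-1 * y + (1 - 2^-1) * x by lra.
have := tangent_le x0 m0; lra.
Qed.

Lemma derive1_increasing x y : 0 < x -> x < y -> derive1 f x < derive1 f y.
Proof.
move=> x0 xy; have y0 := lt_trans x0 xy.
(* Adding the tangent inequalities at [x] and at [y] gives a strict comparison of the two
   derivatives. *)
have := @tangent_lt x y x0 (ltW y0); rewrite gt_eqF// => /(_ isT).
have := @tangent_lt y x y0 (ltW x0); rewrite lt_eqF// => /(_ isT).
nra.
Qed.

Lemma derive1_inj x y : 0 < x -> 0 < y -> derive1 f x = derive1 f y -> x = y.
Proof.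
move=> x0 y0 xy; have [lt_xy|lt_yx|//] := ltgtP x y.
- by have := derive1_increasing x0 lt_xy; rewrite xy ltxx.
- by have := derive1_increasing y0 lt_yx; rewrite xy ltxx.
Qed.

Lemma dfinv_ge0 t : 0 <= dfinv f t.
Proof. by rewrite /dfinv; case: xgetP => // x -> [/ltW]. Qed.

Lemma dfinv_gt0P t : 0 < dfinv f t -> derive1 f (dfinv f t) = t.
Proof. by rewrite /dfinv; case: xgetP => [x -> []//|]; rewrite ltxx. Qed.

Lemma dfinvK x : 0 < x -> dfinv f (derive1 f x) = x.
Proof.
move=> x0; have [] := @xgetPex _ 0 [set y | 0 < y /\ derive1 f y = derive1 f x].
  by exists x.
by move=> y0; exact: derive1_inj.
Qed.

(** Each superlevel set at a level [r >= 0] is the image of an open half-line under the derivative,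
    and such an image is an interval by Darboux. *)
Lemma measurable_dfinv : measurable_fun setT (dfinv f).
Proof.
move=> mT; apply: (measurability _ (RGenOInfty.measurableE R)) => //.
move=> /= _ [_ [r ->] <-]; rewrite setTI.
(* The default value [0] of [dfinv] exceeds every negative level, so then the preimage is the whole
   line. *)
have [r0|r0] := ltP r 0.
  rewrite [X in measurable X](_ : _ = setT)//; apply/seteqP; split => // t _ /=.
  by rewrite in_itv/= andbT (lt_le_trans r0)// dfinv_ge0.
rewrite [X in measurable X](_ : _ = derive1 f @` [set x | r < x]); last first.
  apply/seteqP; split => [t /=|t /= [x rx <-]]; rewrite in_itv/= andbT.
  - by move=> rt; exists (dfinv f t) => //; rewrite dfinv_gt0P// (le_lt_trans r0).
  - by rewrite dfinvK// (le_lt_trans r0).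
apply: is_interval_measurable => _ _ [x rx <-] [y ry <-] t /andP[].
rewrite le_eqVlt => /predU1P[<- _|xt]; first by exists x.
rewrite le_eqVlt => /predU1P[->|ty]; first by exists y.
have xy : x < y.
  rewrite ltNge; apply/negP; rewrite le_eqVlt => /predU1P[yx|yx].
    by move: (lt_trans xt ty); rewrite yx ltxx.
  have := derive1_increasing (le_lt_trans r0 ry) yx.
  by move=> /(lt_trans ty)/(lt_trans xt); rewrite ltxx.
have [||c /andP[xc _] <-] := @derive1_darboux _ f x y t xy.
- move=> s; rewrite in_itv/= => /andP[xs _]; apply: f_der.
  by rewrite (le_lt_trans r0)// (lt_le_trans rx).
- by rewrite xt.
- by exists c => //=; exact: lt_trans xc.
Qed.

(** The tangent inequality at [x] says that the supremum is attained there. *)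
Lemma fstar_derive1 x : 0 < x -> fstar f (derive1 f x) = (derive1 f x * x - f x)%:E.
Proof.
move=> x0; apply/eqP; rewrite eq_le; apply/andP; split.
- apply: ge_ereal_sup => _ [y y0 <-]; rewrite lee_fin.
  by have := tangent_le x0 y0; lra.
- by apply: ereal_sup_ubound; exists x => //=; exact: ltW.
Qed.

Lemma fenchel_young_dfinv t : 0 < dfinv f t ->
  ((f (dfinv f t))%:E + fstar f t = (t * dfinv f t)%:E)%E.
Proof.
move=> t0; rewrite -{2}(dfinv_gt0P t0) fstar_derive1// dfinv_gt0P//.
by rewrite -EFinD addrC subrK.
Qed.

End strictly_convex.

(** * The identity for one dataset *)

Section gibbs_identity.
Local Open Scope ereal_scope.
Context d (T : measurableType d) (R : realType).
Variables (Q Pst : probability T R) (f : R -> R) (lam N : R) (L : T -> R).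
Hypothesis f_sconv : strictly_convex_on_nonneg f.
Hypothesis f_der : forall x : R, (0 < x)%R -> derivable f x 1%R.
Hypothesis lam_gt0 : (0 < lam)%R.
Hypothesis mL : measurable_fun setT L.

Local Notation g := (gibbs_density f lam N L).
Hypothesis g_gt0 : {ae Q, forall x, (0 < g x)%R}.
Hypothesis PstE : forall C, measurable C -> Pst C = \int[Q]_(x in C) (g x)%:E.

Lemma measurable_gibbs_density : measurable_fun setT g.
Proof.
apply: (measurableT_comp (measurable_dfinv f_sconv f_der)).
apply: measurableT_comp => //; apply: measurable_funM => //.
exact: measurable_funD.
Qed.

Let mg : measurable_fun setT (EFin \o g).
Proof. apply/measurable_EFinP; exact: measurable_gibbs_density. Qed.

Let g_ge0 x : 0 <= (EFin \o g) x.
Proof. by rewrite lee_fin; exact: dfinv_ge0. Qed.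

Let Pst_Q : Pst `<< Q.
Proof. exact: density_dominates mg PstE. Qed.

Let Q_Pst : Q `<< Pst.
Proof. exact: dominates_positive_density mg g_ge0 PstE g_gt0. Qed.

Local Notation h := (fun x => (- ((L x + N) / lam))%:E).

Let mh : measurable_fun setT h.
Proof.
apply/measurable_EFinP; apply: measurableT_comp => //.
by apply: measurable_funM => //; exact: measurable_funD.
Qed.

Section one_probability.
Variable P : probability T R.
Hypothesis PQ : P `<< Q.
Hypothesis iL : P.-integrable setT (EFin \o L).

Let ihE : h = (fun x => (- lam^-1)%:E * ((EFin \o L) x + N%:E)).
Proof.
apply/funext => x /=; rewrite -EFinD -EFinM; congr EFin.
by rewrite mulrC mulNr.
Qed.

Let iLN : P.-integrable setT (fun x => (EFin \o L) x + N%:E).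
Proof.
apply: integrableD => //.
exact: (finite_measure_integrable_cst P N).
Qed.

Lemma integrable_gibbs_potential : P.-integrable setT h.
Proof. by rewrite ihE; exact: integrableZl. Qed.

(** The contribution of [N] is the same for every probability [P], hence disappears from
    differences. *)
Lemma integral_gibbs_potential :
  \int[P]_x h x = (- lam^-1)%:E * (\int[P]_x (L x)%:E + N%:E).
Proof.
rewrite ihE integralZl//; congr (_ * _).
rewrite integralD//; last exact: (finite_measure_integrable_cst P N).
by rewrite (integral_cst P measurableT) [X in _ * X]probability_setT mule1.
Qed.

End one_probability.

Lemma integral_gibbs_identity (P P' : probability T R) :
  P `<< Q -> P' `<< Q ->
  P.-integrable setT (EFin \o L) -> P'.-integrable setT (EFin \o L) ->
  \int[Q]_x (((f (g x))%:E + fstar f (- ((L x + N) / lam))) *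
    (('d (charge_of_finite_measure P) '/d Pst) x -
     ('d (charge_of_finite_measure P') '/d Pst) x)) =
  (lam^-1)%:E * (\int[P']_x (L x)%:E - \int[P]_x (L x)%:E).
Proof.
move=> PQ P'Q iL iL'.
have ihP := integrable_gibbs_potential iL.
have ihP' := integrable_gibbs_potential iL'.
(* These are the two halves of the integrand after the chain rule has absorbed the Gibbs density
   into derivatives with respect to [Q]. *)
pose F := fun x => h x * ('d (charge_of_finite_measure P) '/d Q) x.
pose F' := fun x => h x * ('d (charge_of_finite_measure P') '/d Q) x.
have iF : Q.-integrable setT F by exact: integrable_mul_Radon_Nikodym.
have iF' : Q.-integrable setT F' by exact: integrable_mul_Radon_Nikodym.
have PPst := null_dominates_trans PQ Q_Pst.
have P'Pst := null_dominates_trans P'Q Q_Pst.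
(* Only the target [F - F'] has to be measurable, so the composites with [f] and [fstar] are never
   examined for measurability. *)
rewrite (@ae_eq_integral_measurabler _ _ _ Q _ (fun x => F x - F' x)); last 2 first.
- exact: (emeasurable_funB (measurable_int _ iF) (measurable_int _ iF')).
- have dP := Radon_Nikodym_chain_rule (nu := charge_of_finite_measure P) PPst Pst_Q.
  have dP' := Radon_Nikodym_chain_rule (nu := charge_of_finite_measure P') P'Pst Pst_Q.
  have dPst : {ae Q, forall x, (0 < g x)%R /\
      ('d (charge_of_finite_measure Pst) '/d Q) x = (g x)%:E}.
    have := ae_eq_density_Radon_Nikodym Pst_Q mg PstE.
    by apply: filterS2 g_gt0 => x gx /(_ Logic.I).
  apply: filterS3 dPst dP dP' => x [gx dPst].
  move=> /(_ Logic.I) dP /(_ Logic.I) dP' _.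
  rewrite /F /F' dP dP' /= dPst /=.
  (* Finiteness of the derivatives reduces the pointwise identity to ring arithmetic in [R]. *)
  have := @Radon_Nikodym_fin_num _ _ _ (charge_of_finite_measure P) Pst x PPst.
  have := @Radon_Nikodym_fin_num _ _ _ (charge_of_finite_measure P') Pst x P'Pst.
  move=> /fineK <- /fineK <-.
  rewrite [(L x + N)%R]addrC (fenchel_young_dfinv f_sconv f_der gx).
  by rewrite -!(EFinM, EFinB); congr EFin; rewrite -/(g x); ring.
rewrite integralB// !Radon_Nikodym_change_of_variables//.
rewrite !integral_gibbs_potential//.
have /fineK <- := integrable_fin_num measurableT iL.
have /fineK <- := integrable_fin_num measurableT iL'.
rewrite -!(EFinD, EFinN, EFinM); congr EFin; ring.
Qed.

End gibbs_identity.

(** * Kernels and mixtures *)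

Section kernel_of_probabilities.
Local Open Scope ereal_scope.
Context d d' (W : measurableType d) (T : measurableType d') (R : realType).
Variable K : W -> probability T R.
Hypothesis mK : forall C, measurable C -> measurable_fun setT (K ^~ C).

(** Carrying the measurability proof as an argument lets the kernel structure be attached to this
    constant. *)
Definition probability_kernel_of
  of (forall C, measurable C -> measurable_fun setT (K ^~ C)) :
  W -> {measure set T -> \bar R} := K.

Let K' := probability_kernel_of mK.

HB.instance Definition _ := isKernel.Build _ _ W T R K' mK.

Let K'T w : K' w setT = 1. Proof. exact: probability_setT. Qed.

HB.instance Definition _ := Kernel_isProbability.Build _ _ W T R K' K'T.

Definition pker_of : R.-pker W ~> T := K'.

Lemma measurable_integral_probability_kernel (g : W * T -> \bar R) :
  (forall p, 0 <= g p) -> measurable_fun setT g ->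
  measurable_fun setT (fun w => \int[K w]_x g (w, x)).
Proof. exact: (measurable_fun_integral_sfinite_kernel _ pker_of). Qed.

End kernel_of_probabilities.

(** [P] is the composition of [PZ], seen as a kernel from the one-point space, with [K]; the claim
    is then the integral formula for composed kernels. *)
Lemma integral_mixture d d' (Z : measurableType d) (T : measurableType d')
    (R : realType) (PZ : probability Z R) (K : Z -> probability T R)
    (P : probability T R) (g : T -> \bar R) :
  (forall C, measurable C -> measurable_fun setT (K ^~ C)) ->
  (forall C, measurable C -> P C = \int[PZ]_z K z C)%E ->
  (forall x, 0 <= g x)%E -> measurable_fun setT g ->
  (\int[P]_x g x = \int[PZ]_z \int[K z]_x g x)%E.
Proof.
move=> mK PE g0 mg.
pose l : R.-pker unit ~> Z := pker_of (K := fun=> PZ) (fun C _ => measurable_cst _).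
have mK' C : measurable C -> measurable_fun [set: unit * Z] ((fun p => K p.2) ^~ C).
  by move=> mC; exact: measurableT_comp (mK C mC) _.
pose k : R.-pker (unit * Z) ~> T := pker_of mK'.
have <- := integral_kcomp l k tt g0 mg.
by apply: (eq_measure_integral (mkcomp l k tt)) => A mA _; exact: PE.
Qed.

(** * The generalization error as a difference of averaged risks *)

Section generalization_error.
Local Open Scope ereal_scope.
Context d d' (Z : measurableType d) (T : measurableType d') (R : realType).
Variables (L : Z -> T -> R) (PZ : probability Z R) (K : Z -> probability T R).
Variable P : probability T R.
Hypothesis mL : measurable_fun setT (fun p : Z * T => L p.1 p.2).
Hypothesis L0 : forall z x, (0 <= L z x)%R.
Hypothesis mK : forall C, measurable C -> measurable_fun setT (K ^~ C).
Hypothesis PE : forall C, measurable C -> P C = \int[PZ]_z K z C.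
Hypothesis finP : \int[PZ]_z \int[P]_x (L z x)%:E < +oo.
Hypothesis finK : \int[PZ]_z \int[K z]_x (L z x)%:E < +oo.

Let mLz z : measurable_fun setT (L z).
Proof. exact: (measurableT_comp mL (pair1_measurable z)). Qed.

(** The first coordinate is the training dataset, the second the dataset on which the risk is
    evaluated; the diagonal is the training risk. *)
Let r (p : Z * Z) := \int[K p.1]_x (L p.2 x)%:E.

Let r0 p : 0 <= r p.
Proof. by apply: integral_ge0 => x _; rewrite lee_fin. Qed.

Let mr : measurable_fun setT r.
Proof.
apply: (@measurable_integral_probability_kernel _ _ _ _ _
  (fun p => K p.1) _ (fun q : (Z * Z) * T => (L q.1.2 q.2)%:E)).
- by move=> C mC; exact: measurableT_comp (mK mC) _.
- by move=> p; rewrite lee_fin.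
- apply/measurable_EFinP.
  apply: (measurableT_comp (f := fun p : Z * T => L p.1 p.2)
    (g := fun q : (Z * Z) * T => (q.1.2, q.2))) => //.
  apply: measurable_fun_pair; last exact: measurable_snd.
  exact: (measurableT_comp measurable_snd measurable_fst).
Qed.

Let PrE z : \int[P]_x (L z x)%:E = \int[PZ]_u r (u, z).
Proof.
apply: integral_mixture => //; first by move=> x; rewrite lee_fin.
exact/measurable_EFinP.
Qed.

Let ge0_lty_integrable (g : Z -> \bar R) : (forall z, 0 <= g z) ->
  measurable_fun setT g -> \int[PZ]_z g z < +oo -> PZ.-integrable setT g.
Proof.
move=> g0 mg fg; apply/integrableP; split => //.
by under eq_integral do rewrite gee0_abs//.
Qed.

Let mrdiag : measurable_fun setT (fun z => r (z, z)).
Proof.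
by apply: (measurableT_comp mr); exact: measurable_fun_pair.
Qed.

Lemma integrable_mixture_risk :
  PZ.-integrable setT (fun z => \int[P]_x (L z x)%:E).
Proof.
apply: ge0_lty_integrable => //.
- by move=> z; apply: integral_ge0 => x _; rewrite lee_fin.
- rewrite (_ : (fun z => _) = (fun z => \int[PZ]_u r (u, z))).
    exact: (measurable_fun_fubini_tonelli_G (m1 := PZ) r).
  by apply/funext => z; exact: PrE.
Qed.

Lemma integrable_own_risk :
  PZ.-integrable setT (fun z => \int[K z]_x (L z x)%:E).
Proof. exact: (@ge0_lty_integrable (fun z => r (z, z))). Qed.

Lemma gen_errorE :
  gen_error L (fun z => K z : {measure set T -> \bar R}) PZ =
  \int[PZ]_z (\int[P]_x (L z x)%:E - \int[K z]_x (L z x)%:E).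
Proof.
pose A z := \int[PZ]_u r (z, u).
(* Tonelli exchanges training and test datasets; averaging over the training one turns [K] into
   [P]. *)
have AE : \int[PZ]_z A z = \int[PZ]_z \int[P]_x (L z x)%:E.
  rewrite (fubini_tonelli (m1 := PZ) (m2 := PZ) r mr r0).
  by apply: eq_integral => z _; rewrite PrE.
have mA : measurable_fun setT A.
  exact: (measurable_fun_fubini_tonelli_F (m2 := PZ) r).
have iA : PZ.-integrable setT A.
  apply: ge0_lty_integrable => //; last by rewrite AE.
  by move=> z; exact: integral_ge0.
have iB := integrable_own_risk.
rewrite /gen_error /risk.
rewrite (@ae_eq_integral_measurabler _ _ _ PZ _
  (fun z => A z - \int[K z]_x (L z x)%:E)); last 2 first.
- exact: (emeasurable_funB mA (measurable_int _ iB)).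
(* For almost every [z] both [A z] and the training risk are finite, so the inner integral splits;
   the training risk is constant in [u]. *)
- have := integrable_ae measurableT iB.
  apply: filterS2 (integrable_ae measurableT iA) => z.
  move=> /(_ Logic.I) Az /(_ Logic.I) Bz _.
  have mrz : measurable_fun setT (fun u => r (z, u)).
    exact: (measurableT_comp mr (pair1_measurable z)).
  rewrite (integralB (mu := PZ) measurableT (f1 := fun u => r (z, u))).
  + by rewrite (integral_cst PZ measurableT) [X in _ * X]probability_setT mule1.
  + apply: ge0_lty_integrable => //.
    by rewrite ltey_eq Az.
  + rewrite -(fineK Bz); exact: finite_measure_integrable_cst.
rewrite integralB// AE -integralB//.
exact: integrable_mixture_risk.
Qed.

End generalization_error.

(** * The empirical risk and the final assembly *)

Lemma emp_risk_ge0 (R : realType) dT dX dY (T : measurableType dT)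
    (X : measurableType dX) (Y : measurableType dY) n (h : T -> X -> Y)
    (ell : Y -> Y -> R) (z : n.-tuple (X * Y)%type) (x : T) :
  (forall y y', 0 <= ell y y') -> 0 <= emp_risk h ell z x.
Proof. by move=> ell0; rewrite mulr_ge0// sumr_ge0. Qed.

Lemma measurable_emp_risk (R : realType) dT dX dY (T : measurableType dT)
    (X : measurableType dX) (Y : measurableType dY) n (h : T -> X -> Y)
    (ell : Y -> Y -> R) :
  measurable_fun [set: T * X] (fun p : T * X => h p.1 p.2) ->
  measurable_fun [set: Y * Y] (fun p : Y * Y => ell p.1 p.2) ->
  measurable_fun [set: n.-tuple (X * Y)%type * T]
    (fun p : n.-tuple (X * Y)%type * T => emp_risk h ell p.1 p.2).
Proof.
move=> mh mell; apply: measurable_funM => //.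
apply: measurable_sum => i.
have mi : measurable_fun [set: n.-tuple (X * Y)%type * T]
    (fun p : n.-tuple (X * Y)%type * T => tnth p.1 i).
  exact: (measurableT_comp (measurable_tnth i) measurable_fst).
apply: (measurableT_comp (f := fun p : Y * Y => ell p.1 p.2)
  (g := fun p : n.-tuple (X * Y)%type * T =>
    (h p.2 (tnth p.1 i).1, (tnth p.1 i).2))) => //.
apply: measurable_fun_pair; last exact: (measurableT_comp measurable_snd mi).
apply: (measurableT_comp (f := fun p : T * X => h p.1 p.2)
  (g := fun p : n.-tuple (X * Y)%type * T => (p.2, (tnth p.1 i).1))) => //.
apply: measurable_fun_pair; first exact: measurable_snd.
exact: (measurableT_comp measurable_fst mi).
Qed.

Unset Implicit Arguments.
Set Strict Implicit.

Theorem theorem5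
  (R : realType) (dT dX dY : measure_display)
  (T : measurableType dT) (X : measurableType dX) (Y : measurableType dY)
  (n : nat) (n_gt0 : (0 < n)%N)
  (h : T -> X -> Y) (ell : Y -> Y -> R)
  (h_meas : measurable_fun [set: T * X] (fun p : T * X => h p.1 p.2))
  (ell_meas : measurable_fun [set: Y * Y] (fun p : Y * Y => ell p.1 p.2))
  (ell_ge0 : forall y y' : Y, 0 <= ell y y')
  (ell_refl : forall y : Y, ell y y = 0)
  (Q : probability T R) (lam : R) (lam_gt0 : 0 < lam)
  (f : R -> R) (f1 : f 1 = 0)
  (* assumption (a) *)
  (f_sconv : strictly_convex_on_nonneg f)
  (f_der : forall x : R, 0 < x -> derivable f x 1)
  (* the data distribution and the learning algorithm *)
  (PZ : probability (n.-tuple (X * Y)%type) R)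
  (K : n.-tuple (X * Y)%type -> probability T R)
  (K_meas : forall C : set T, measurable C ->
     measurable_fun [set: n.-tuple (X * Y)%type] (K ^~ C))
  (PTheta : probability T R)
  (PTheta_def : forall C : set T, measurable C ->
     PTheta C = (\int[PZ]_z K z C)%E)
  (* assumption (b), for every dataset z *)
  (hb : forall z : n.-tuple (X * Y)%type,
     exists beta : R, normalizing Q f lam (emp_risk h ell z) beta)
  (* P^{(Q,lambda)}_{Theta|Z=z}, given through its density w.r.t. Q *)
  (Pst : n.-tuple (X * Y)%type -> probability T R)
  (Pst_def : forall z (C : set T), measurable C ->
     Pst z C = (\int[Q]_(theta in C)
       (gibbs_density f lam (normalizer Q f lam (emp_risk h ell z))
          (emp_risk h ell z) theta)%:E)%E)
  (* assumptions (d) and (e) *)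
  (hd1 : forall z, K z `<< PTheta)
  (hd2 : PTheta `<< Q)
  (he : Q `<< PTheta)
  (* finiteness of the risks (well-definedness of the generalization error) *)
  (int1 : (\int[PZ]_z \int[PTheta]_theta (emp_risk h ell z theta)%:E < +oo)%E)
  (int2 : (\int[PZ]_z \int[K z]_theta (emp_risk h ell z theta)%:E < +oo)%E) :
  gen_error (emp_risk h ell) (fun z => K z : {measure set T -> \bar R}) PZ =
  (lam%:E * \int[PZ]_z \int[Q]_theta
     (((f (gibbs_density f lam (normalizer Q f lam (emp_risk h ell z))
                 (emp_risk h ell z) theta))%:E
       + fstar f (- ((emp_risk h ell z theta
                      + normalizer Q f lam (emp_risk h ell z)) / lam)))
      * (('d (charge_of_finite_measure (K z)) '/d (Pst z)) theta
         - ('d (charge_of_finite_measure PTheta) '/d (Pst z)) theta)))%E.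

Proof.
pose L := emp_risk h ell : n.-tuple (X * Y)%type -> T -> R.
have mL := measurable_emp_risk (n := n) h_meas ell_meas.
have L0 z x : 0 <= L z x by exact: emp_risk_ge0.
have iP := integrable_mixture_risk mL L0 K_meas PTheta_def int1.
have iK := integrable_own_risk mL L0 K_meas int2.
rewrite (gen_errorE mL L0 K_meas PTheta_def int1 int2).
have mPK := measurable_int _ (integrableB measurableT iP iK).
(* The one-dataset identity needs finite risks under both [PTheta] and [K z], which hold for almost
   every [z]. *)
rewrite [in RHS](@ae_eq_integral_measurabler _ _ _ PZ _ (fun z => (lam^-1)%:E *
  (\int[PTheta]_x (L z x)%:E - \int[K z]_x (L z x)%:E))%E); last 2 first.
- exact: emeasurable_funM.
- have := integrable_ae measurableT iK.
  apply: filterS2 (integrable_ae measurableT iP) => z.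
  move=> /(_ Logic.I) Pz /(_ Logic.I) Kz _.
  have mLz : measurable_fun setT (L z).
    exact: (measurableT_comp mL (pair1_measurable z)).
  have iL (P : probability T R) : (\int[P]_x (L z x)%:E \is a fin_num)%E ->
      P.-integrable setT (EFin \o L z).
    move=> Pfin; apply/integrableP; split; first exact/measurable_EFinP.
    under eq_integral do rewrite gee0_abs ?lee_fin//.
    by rewrite ltey_eq Pfin.
  (* By [hb] the chosen [normalizer] is a true normalizing constant, not the default [0]; [g0] is
     the positivity it provides. *)
  have [g0 _] := xgetPex 0 (hb z).
  rewrite -(integral_gibbs_identity f_sconv f_der mLz g0 (Pst_def z)) //.
  + exact: null_dominates_trans (hd1 z) hd2.
  + exact: iL.
  + exact: iL.
rewrite integralZl//; last exact: (integrableB measurableT iP iK).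
by rewrite muleA -EFinM divff ?gt_eqF// mul1e.
Qed.
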